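(* Let $\mathcal{W}=\{(W_i,\omega_i)\}_{i\in I}$ be a fusion Riesz basis for $\mathcal{H}$ with fusion frame operator $S_{\mathcal{W}}$, let $\omega^{-1}:=\{\omega_i^{-1}\}_{i\in I}$, and let $U\in B(\mathcal{H})$ be an invertible operator. Then the following are equivalent: (i) $\mathcal{W}$ is $(U,\omega^{-1})$-scalable. (ii) $\mathcal{W}$ is $\left((S_{\mathcal{W}}U^* )^{-1},\omega^{-1}\right)$-scalable. (iii) $U^*UW_i=S_{\mathcal{W}}^{-1}W_i$ for all $i\in I$. (iv) $\{(UW_i,\omega_i)\}_{i\in I}$ is an orthogonal fusion Riesz basis.
   Context: $\mathcal{H}$ is a separable Hilbert space, $B(\mathcal{H})$ the bounded operators on $\mathcal{H}$, $I$ a countable index set, $\pi_W$ the orthogonal projection onto a closed subspace $W$. A family of weights is a family of strictly positive numbers. For closed subspaces $W_i$ and weights $\omega_i$, $\mathcal{W}=\{(W_i,\omega_i)\}_{i\in I}$ is a fusion frame for $\mathcal{H}$ if there are $0<A\le B<\infty$ with $A\|f\|^2\le\sum_{i\in I}\omega_i^2\|\pi_{W_i}f\|^2\le B\|f\|^2$ for all $f\in\mathcal{H}$; it is Parseval if $A=B=1$ can be taken. The fusion frame operator is $S_{\mathcal{W}}f=\sum_{i\in I}\omega_i^2\pi_{W_i}f$; it is bounded, positive, self-adjoint and invertible for a fusion frame. $\mathcal{W}$ is a fusion Riesz basis if $\{W_i\}_{i\in I}$ is complete in $\mathcal{H}$ (the closed linear span of $\bigcup_i W_i$ is $\mathcal{H}$)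 and there are constants $C,D>0$ such that for every finite $J\subset I$ and all $f_j\in W_j$ $(j\in J)$, $C\sum_{j\in J}\|f_j\|^2\le\|\sum_{j\in J}\omega_jf_j\|^2\le D\sum_{j\in J}\|f_j\|^2$. Every fusion Riesz basis is a fusion frame. A fusion Riesz basis is orthogonal if its subspaces are pairwise orthogonal. For an invertible $U\in B(\mathcal{H})$ and a family of weights $\gamma=\{\gamma_i\}_{i\in I}$, a fusion frame $\mathcal{W}$ is called $(U,\gamma)$-scalable if $\{(UW_i,\omega_i\gamma_i)\}_{i\in I}$ is a Parseval fusion frame for $\mathcal{H}$. *)

(* Defs.v *)
From HB Require Import structures.
From mathcomp Require Import all_boot all_order all_algebra finmap complex.
From mathcomp Require Import sesquilinear.
From mathcomp Require Import all_classical all_reals all_analysis.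
From mathcomp Require Import summability.

Set Implicit Arguments.
Unset Strict Implicit.
Unset Printing Implicit Defensive.

Import Order.TTheory GRing.Theory Num.Theory.
Import numFieldNormedType.Exports.

Local Open Scope classical_set_scope.
Local Open Scope ring_scope.

(* The scalar field of a Hilbert space together with its conjugation: the real
   numbers or the complex numbers. *)
Variant scalar_field (R : realType) : forall K : numFieldType, (K -> K) -> Prop :=
| RealScalars : @scalar_field R R idfun
| ComplexScalars : @scalar_field R R[i] Num.conj.

Definition separable_space (T : topologicalType) : Prop :=
  exists2 D : set T, countable D & dense D.

(* The scalars K are only a numFieldType, whose order is partial: 0 < a forces a
   to be real, and norms of vectors are (nonnegative real) elements of K. *)
Section HilbertSpace.

Variables (K : numFieldType) (theta : K -> K) (H : completeNormedModType K).

(* dot is linear in its first argument and theta-linear in the second. *)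
Variable dot : {dot H for theta}.

(* The complete norm of H is the one of the inner product. *)
Definition hilbert_space : Prop := forall x : H, `|x| ^+ 2 = dot x x.

Definition bounded_op (T : H -> H) : Prop :=
  linear T /\ exists M : K, forall x, `|T x| <= M * `|x|.

Definition invertible_op (T : H -> H) : Prop :=
  bounded_op T /\
  exists T' : H -> H, [/\ bounded_op T', cancel T T' & cancel T' T].

(* The two-sided inverse of T when T is bijective. *)
Definition inverse_op (T : H -> H) : H -> H := 'pinv_(fun=> 0) [set: H] T.

(* For a bounded T, adjoint T y is the only element of the set below. *)
Definition adjoint (T : H -> H) (y : H) : H :=
  xget 0 [set z | forall x, dot (T x) y = dot x z].

Definition linear_subspace (V : set H) : Prop :=
  V 0 /\ forall (a : K) x y, V x -> V y -> V (a *: x + y).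

Definition closed_subspace (V : set H) : Prop := linear_subspace V /\ closed V.

(* For a closed subspace V, orthproj V f is the only p in V such that f - p is
   orthogonal to V. *)
Definition orthproj (V : set H) (f : H) : H :=
  xget 0 [set p | V p /\ forall v, V v -> dot (f - p) v = 0].

Definition closed_span (A : set H) : set H := closure (smallest linear_subspace A).

Section Fusion.

Variable I : countType.

Implicit Types (W : I -> set H) (w : I -> K).

Definition weights w : Prop := forall i, 0 < w i.

Definition weighted_subspaces W w : Prop :=
  (forall i, closed_subspace (W i)) /\ weights w.

(* Sums over I are limits along the net of finite partial sums. As `sum` has an
   arbitrary value on a divergent family, convergence is required explicitly:
   it expresses that the sum of nonnegative terms is finite. *)
Definition frame_bounds W w (A B : K) : Prop := forall f : H,
  let t := fun i => w i ^+ 2 * `|orthproj (W i) f| ^+ 2 : K^o in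
  [/\ cvg (partial_sum t @ totally),
      A * `|f| ^+ 2 <= sum t & sum t <= B * `|f| ^+ 2].

Definition fusion_frame W w : Prop :=
  weighted_subspaces W w /\
  exists A B : K, [/\ 0 < A, A <= B & frame_bounds W w A B].

Definition Parseval_fusion_frame W w : Prop :=
  weighted_subspaces W w /\ frame_bounds W w 1 1.

Definition frame_operator W w (f : H) : H :=
  sum (fun i => w i ^+ 2 *: orthproj (W i) f).

Definition fusion_Riesz_basis W w : Prop :=
  [/\ weighted_subspaces W w,
      closed_span (\bigcup_i W i) = [set: H] &
      exists C D : K, [/\ 0 < C, 0 < D &
        forall (J : {fset I}) (f : I -> H), (forall j, j \in J -> W j (f j)) ->
          C * (\sum_(j <- J) `|f j| ^+ 2) <= `|\sum_(j <- J) w j *: f j| ^+ 2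
          /\ `|\sum_(j <- J) w j *: f j| ^+ 2 <= D * (\sum_(j <- J) `|f j| ^+ 2)]].

Definition orthogonal_fusion_Riesz_basis W w : Prop :=
  fusion_Riesz_basis W w /\
  forall i j, i != j -> forall x y, W i x -> W j y -> dot x y = 0.

(* The notion is only defined for a fusion frame, an invertible operator and a
   family of weights, hence the first three conditions. *)
Definition fusion_scalable W w (U : H -> H) (g : I -> K) : Prop :=
  [/\ fusion_frame W w, invertible_op U, weights g &
      Parseval_fusion_frame (fun i => U @` W i) (fun i => w i * g i)].

End Fusion.

End HilbertSpace.

(* Main.v *)
Require Import Defs.
From HB Require Import structures.
From mathcomp Require Import all_boot all_order all_algebra finmap complex.
From mathcomp Require Import sesquilinear.
From mathcomp Require Import all_classical all_reals all_analysis.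
From mathcomp Require Import summability ring.

Set Implicit Arguments.
Unset Strict Implicit.
Unset Printing Implicit Defensive.

Import Order.TTheory GRing.Theory Num.Theory.
Import numFieldNormedType.Exports.

Local Open Scope classical_set_scope.
Local Open Scope ring_scope.

(** Everything rests on one description of the frame operator [S] of a fusion
    Riesz basis: [S^-1 W_i] is the space [M_i] of the vectors orthogonal to
    every [W_j] with [j != i] ([frame_inverse_image]). Indeed, if
    [S g = f] lies in [W_i], then the expansion
    [sum_j w_j^2 pi_j g = f] and the lower Riesz bound, which makes the
    coefficients of an unconditional expansion unique ([Riesz_sum_eq0]), force
    [pi_j g = 0] for [j != i]; conversely, for [g] in [M_i] the series of [S g]
    has the single term [w_i^2 pi_i g].

    Let [V] be an invertible operator. The family [V W_i] with the weights
    [w_i] is again a fusion Riesz basis ([Riesz_image]), so condition (iv) only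
    says that the [V W_i] are pairwise orthogonal. Since the weights
    [w_i w_i^-1] are 1, scalability says that the [V W_i] form a Parseval
    family with unit weights, and this too is pairwise orthogonality: if [f] is
    in [V W_i], then [|f|^2 = sum_j |pi_j f|^2] already has the term [|f|^2],
    so the other terms vanish ([Parseval_orthogonal]); conversely, an
    orthogonal complete family of closed subspaces has the identity as its
    frame operator ([orthogonal_Parseval]). Orthogonality gives
    [V^* V W_i = M_i] ([adjoint_square_image]): the inclusion in [M_i] is
    immediate, and for [g] in [M_i] the vector [V^*^-1 g] is orthogonal to
    every [V W_j] with [j != i], hence belongs to [V W_i] by completeness. Thus
    (iv) implies (iii), and (iii) implies (iv) because
    [<U x, U y> = <x, U^* U y>].

    Finally let [V = (S U^* )^-1]. Under (iii), [V W_i = U^*^-1 S^-1 W_i] is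
    [U W_i], so (i) implies (ii). Conversely [V^* = S^-1 U^-1] because [S] is
    symmetric, and the identity [V^* V W_i = S^-1 W_i], which follows from (ii),
    reads [U^-1 V W_i = W_i]; applying [U^* U] to both sides and using
    [U^* V = S^-1] gives (iii).

    The analytic input is the invertibility of [S], which comes from
    [C |f|^2 <= <S f, f>] ([frame_form_lower]), and the existence of orthogonal
    projections and adjoints. The real and complex cases are treated together:
    the only facts used about the scalars are the rules of conjugation and the
    existence of suprema of bounded sets of nonnegative scalars. *)

(** * The two scalar fields *)

Section Scalars.
Variables (R : realType) (K : numFieldType) (theta : K -> K).
Hypothesis hK : scalar_field R theta.

Lemma scalar_conjM a b : theta (a * b) = theta a * theta b.
Proof. by case: hK a b => // a b; rewrite rmorphM. Qed.

Lemma scalar_conjK a : theta (theta a) = a.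
Proof. by case: hK a => // a; rewrite conjCK. Qed.

Lemma scalar_conj_nneg a : 0 <= a -> theta a = a.
Proof. by case: hK a => // a /geC0_conj. Qed.

(** The order of the complex numbers is only partial, but nonnegative complex
    numbers are real, so that the supremum can be taken among the reals. *)
Lemma scalar_sup (A : set K) (M : K) : A !=set0 ->
  (forall a, A a -> 0 <= a <= M) ->
  exists2 s, (forall a, A a -> a <= s) &
    forall m, 0 <= m -> (forall a, A a -> a <= m) -> s <= m.
Proof.
case: hK A M => A M A0 AM.
  exists (reals.sup A) => [a Aa|m _ mA].
    by apply: ub_le_sup => //; exists M => b /AM /andP[].
  by apply: ge_sup => // b /mA.
pose B := [set r : R | A (r%:C)%C].
have AB a : A a -> a = ((complex.Re a)%:C)%C.
  by move=> /AM /andP[]; case: a => x y; rewrite lecE /= => /andP[/eqP-> _].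
have B0 : B !=set0 by case: A0 => a Aa; exists (complex.Re a); rewrite /B /= -AB.
have BM m : (forall a, A a -> a <= m) -> ubound B (complex.Re m).
  by move=> mA b /mA; case: m {mA} => x y; rewrite lecE /= => /andP[].
exists ((reals.sup B)%:C)%C => [a Aa|m m0 mA].
  rewrite (AB _ Aa) lecR; apply: ub_le_sup; last by rewrite /B /= -AB.
  by exists (complex.Re M); apply: BM => b /AM /andP[].
have : reals.sup B <= complex.Re m by apply: ge_sup => //; exact: BM.
case: m m0 {mA} => x y; rewrite !lecE /= => /andP[/eqP-> _] ->.
by rewrite eqxx.
Qed.

End Scalars.

(** * Unordered sums *)

Section Sums.
Variables (K : numFieldType) (I : choiceType).

Lemma partial_sumE (V : zmodType) (x : I -> V) (J : {fset I}) :
  partial_sum x J = \sum_(j <- J) x j.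
Proof. by rewrite /partial_sum big_seq_fsetE. Qed.

Lemma cvg_sumP (V : normedModType K) (x : I -> V) (l : V) :
  (partial_sum x @ totally --> l) <->
  (forall e : K, 0 < e -> exists J0 : {fset I}, forall J : {fset I},
     (J0 `<=` J)%fset -> `|l - \sum_(j <- J) x j| < e).
Proof.
have FF : Filter (@totally I) by exact: totally_filter.
rewrite cvgrPdist_lt; split=> h e e0; have := h e e0.
  by case=> J0 _ hJ; exists J0 => J /hJ /=; rewrite partial_sumE.
by case=> J0 hJ; exists J0 => // J /hJ /=; rewrite partial_sumE.
Qed.

Lemma sum_unique (V : normedModType K) (x : I -> V) (l : V) :
  partial_sum x @ totally --> l -> sum x = l.
Proof.
have FF : ProperFilter (@totally I) by exact: totally_filter.
by move=> h; apply: cvg_lim => //; exact: norm_hausdorff.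
Qed.

Lemma cvg_sum_unique (V : normedModType K) (x : I -> V) (l l' : V) :
  partial_sum x @ totally --> l -> partial_sum x @ totally --> l' -> l = l'.
Proof. by move=> /sum_unique <- /sum_unique <-. Qed.

Lemma cvg_sum_linear (V V' : normedModType K) (phi : {linear V -> V'})
    (x : I -> V) (l : V) :
  continuous phi -> partial_sum x @ totally --> l ->
  partial_sum (phi \o x) @ totally --> phi l.
Proof.
move=> phiC xl.
have -> : partial_sum (phi \o x) = phi \o partial_sum x.
  by apply/funext => J; rewrite /= !partial_sumE linear_sum.
exact: (cvg_comp _ _ xl (phiC l)).
Qed.

Lemma cvg_sum_single (V : normedModType K) (x : I -> V) i :
  (forall j, j != i -> x j = 0) -> partial_sum x @ totally --> x i.
Proof.
move=> x0; apply/cvg_sumP => e e0; exists [fset i]%fset => J.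
rewrite fsub1set => iJ.
rewrite (big_fsetD1 i) //= big1_fset ?addr0 ?subrr ?normr0 //.
by move=> j; rewrite !inE => /andP[ji _] _; exact: x0.
Qed.

Lemma ler_fset_sum (t : I -> K) (J J' : {fset I}) : (forall i, 0 <= t i) ->
  (J `<=` J')%fset -> \sum_(j <- J) t j <= \sum_(j <- J') t j.
Proof.
move=> t0 JJ'; rewrite [leRHS](big_fsetID _ (mem J)) /=.
have -> : [fset x | x in J' & x \in J]%fset = J.
  apply/fsetP => i; rewrite !inE andbC; case iJ: (i \in J) => //=.
  exact: (fsubsetP JJ').
by rewrite lerDl sumr_ge0.
Qed.

(** A limit of partial sums is comparable to them only when it is real, which
    does not follow from convergence alone in a partially ordered field. *)
Lemma cvg_nneg_sum_ge (t : I -> K) (l : K) (J : {fset I}) :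
  (forall i, 0 <= t i) -> l \is Num.real ->
  partial_sum (t : I -> K^o) @ totally --> (l : K^o) -> \sum_(j <- J) t j <= l.
Proof.
move=> t0 lr /cvg_sumP h.
have sr (A : {fset I}) : \sum_(j <- A) t j \is Num.real.
  by apply: ger0_real; exact: sumr_ge0.
rewrite real_leNgt //; apply/negP => lJ.
have [|J0 hJ0] := h (\sum_(j <- J) t j - l); first by rewrite subr_gt0.
have := hJ0 _ (fsubsetUl J0 J); rewrite distrC => /lt_geF/negP; apply.
apply: le_trans (real_ler_norm _); last by rewrite realB.
by rewrite lerB // ler_fset_sum // fsubsetUr.
Qed.

Lemma cvg_nneg_sum_le (t : I -> K) (l M : K) :
  (forall i, 0 <= t i) -> l \is Num.real ->
  (forall J : {fset I}, \sum_(j <- J) t j <= M) ->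
  partial_sum (t : I -> K^o) @ totally --> (l : K^o) -> l <= M.
Proof.
move=> t0 lr tM /cvg_sumP h.
have M0 : 0 <= M by have := tM fset0; rewrite big_seq_fset0.
rewrite real_leNgt ?(ger0_real M0) //; apply/negP => Ml.
have [|J0 /(_ _ (fsubset_refl _))] := h (l - M); first by rewrite subr_gt0.
have sr : \sum_(j <- J0) t j \is Num.real by apply: ger0_real; exact: sumr_ge0.
move=> /lt_geF/negP; apply; apply: le_trans (real_ler_norm _); last by rewrite realB.
by rewrite lerB.
Qed.

Lemma cvg_sumB (V : normedModType K) (x y : I -> V) (l m : V) :
  partial_sum x @ totally --> l -> partial_sum y @ totally --> m ->
  partial_sum (fun i => x i - y i) @ totally --> l - m.
Proof.
have FF : Filter (@totally I) by exact: totally_filter.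
move=> xl ym; rewrite (_ : partial_sum _ = fun J => partial_sum x J - partial_sum y J).
  exact: cvgB xl ym.
by apply/funext => J; rewrite !partial_sumE sumrB.
Qed.

Lemma big_fset_split (V : zmodType) (x : I -> V) (J0 J : {fset I}) :
  (J0 `<=` J)%fset ->
  \sum_(j <- J) x j = \sum_(j <- J0) x j + \sum_(j <- (J `\` J0)%fset) x j.
Proof.
move=> JJ; rewrite (big_fsetID _ (mem J0)) /=; congr (_ + _); apply: eq_fbigl => i.
  rewrite !inE andbC; case iJ: (i \in J0) => //=; exact: (fsubsetP JJ).
by rewrite !inE andbC.
Qed.

(** The sum of the squares of [a j - c * b j] is nonnegative; [c] is the value
    that minimizes it. *)
Lemma cauchy_schwarz_sum (a b : I -> K) (J : {fset I}) :
  (forall i, 0 <= a i) -> (forall i, 0 <= b i) ->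
  (\sum_(j <- J) a j * b j) ^+ 2 <=
  (\sum_(j <- J) a j ^+ 2) * (\sum_(j <- J) b j ^+ 2).
Proof.
move=> a0 b0; set P := \sum_(j <- J) a j * b j.
set A := \sum_(j <- J) a j ^+ 2; set B := \sum_(j <- J) b j ^+ 2.
have P0 : 0 <= P by apply: sumr_ge0 => i _; rewrite mulr_ge0.
have B0 : 0 <= B by apply: sumr_ge0 => i _; rewrite exprn_ge0.
have [B00|Bn0] := eqVneq B 0.
  suff -> : P = 0 by rewrite expr0n B00 mulr0.
  rewrite /P big_seq big1 // => j jJ; suff -> : b j = 0 by rewrite mulr0.
  apply/eqP; rewrite -sqrf_eq0; move/eqP: B00.
  by rewrite psumr_eq0 => [/allP/(_ _ jJ)//|i _]; rewrite exprn_ge0.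
have Bgt0 : 0 < B by rewrite lt_def Bn0.
pose c := P / B.
have : 0 <= \sum_(j <- J) (a j - c * b j) ^+ 2.
  apply: sumr_ge0 => j _; apply: real_exprn_even_ge0 => //.
  by rewrite realB ?realM ?ger0_real ?mulr_ge0 ?invr_ge0.
have -> : \sum_(j <- J) (a j - c * b j) ^+ 2 = A - c * P *+ 2 + c ^+ 2 * B.
  rewrite /A /P /B !mulr_sumr -sumrMnl -sumrB -big_split /=.
  by apply: eq_bigr => j _; ring.
have -> : A - c * P *+ 2 + c ^+ 2 * B = A - P ^+ 2 / B by rewrite /c; field.
by rewrite subr_ge0 ler_pdivrMr.
Qed.

Lemma cvg_sum_norm_le (V : normedModType K) (x : I -> V) (l : V) (M : K) :
  (forall J : {fset I}, `|\sum_(j <- J) x j| <= M) ->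
  partial_sum x @ totally --> l -> `|l| <= M.
Proof.
move=> xM /cvg_sumP h; apply/ler_addgt0Pr => e /h [J /(_ _ (fsubset_refl _)) hJ].
rewrite -[l](subrK (\sum_(j <- J) x j)) (le_trans (ler_normD _ _)) //.
by rewrite addrC lerD // ltW.
Qed.

End Sums.

Section NnegSums.
Variables (R : realType) (K : numFieldType) (theta : K -> K).
Hypothesis hK : scalar_field R theta.

Lemma cvg_nneg_sum (I : choiceType) (t : I -> K) (M : K) :
  (forall i, 0 <= t i) -> (forall J : {fset I}, \sum_(j <- J) t j <= M) ->
  exists2 l : K, 0 <= l & partial_sum (t : I -> K^o) @ totally --> (l : K^o).
Proof.
move=> t0 tM; pose A := [set a | exists J : {fset I}, a = \sum_(j <- J) t j].
have [||l lA lm] := @scalar_sup _ _ _ hK A M.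
- by exists (\sum_(j <- fset0) t j), fset0.
- by move=> _ [J ->]; rewrite tM sumr_ge0.
have l0 : 0 <= l by apply: lA; exists fset0; rewrite big_seq_fset0.
exists l => //; apply/cvg_sumP => e e0.
have [[J0 hJ0]|hn] := pselect (exists J : {fset I}, l - e < \sum_(j <- J) t j).
  exists J0 => J J0J.
  rewrite ger0_norm; last by rewrite subr_ge0; apply: lA; exists J.
  by rewrite ltrBlDr addrC -ltrBlDr (lt_le_trans hJ0) // ler_fset_sum.
have le : forall J : {fset I}, \sum_(j <- J) t j <= l - e.
  move=> J; rewrite real_leNgt.
  - by apply/negP => h; apply: hn; exists J.
  - by apply: ger0_real; exact: sumr_ge0.
  - by rewrite realB ?ger0_real // ltW.
have : l <= l - e.
  apply: lm => [|_ [J ->] //].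
  by have := le fset0; rewrite big_seq_fset0.
by rewrite lerDl oppr_ge0 => /(lt_le_trans e0); rewrite ltxx.
Qed.

End NnegSums.

(** Closedness of an inequality, for functions that take real values in a
    partially ordered field. *)
Lemma closed_nneg (K : numFieldType) (H : normedModType K) (g : H -> K) :
  (forall x, g x \is Num.real) -> continuous (g : H -> K^o) ->
  closed [set x | 0 <= g x].
Proof.
move=> gr gC x xcl /=; rewrite real_leNgt //; apply/negP => gx0.
have /(gC x) : nbhs (g x : K^o) [set y : K^o | `|g x - y| < - g x].
  by have := nbhsx_ballx (g x : K^o) (- g x); rewrite oppr_gt0 -ball_normE; exact.
move=> /xcl [y [/= gy0]]; move=> /lt_geF/negP; apply.
rewrite distrC (le_trans _ (real_ler_norm _)) ?realB //.
by rewrite lerDr.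
Qed.

(** * Linear maps as plain functions *)

Section LinearMaps.
Variables (K : numFieldType).

(** Operators are plain functions with a proof of linearity; this lemma gives
    access to the theory of linear maps after replacing such a function by a
    bundled one. *)
Lemma linear_bundle (V V' : lmodType K) (f : V -> V') :
  linear f -> exists L : {linear V -> V'}, (L : V -> V') = f.
Proof.
move=> lf.
pose m := GRing.isLinear.Build K V V' _ f lf.
pose L : {linear V -> V'} := HB.pack f m.
by exists L.
Qed.

Lemma bounded_by_continuous (V V' : normedModType K) (f : {linear V -> V'}) (M : K) :
  (forall x, `|f x| <= M * `|x|) -> continuous f.
Proof.
move=> fM; apply/linear_bounded_continuous/linear_boundedP.
near=> r => x; have : `|M| <= r by near: r; apply: nbhs_pinfty_ge; exact: normr_real.
move=> Mr; apply: le_trans (ler_wpM2r _ Mr) => //.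
have MxE : M * `|x| \is Num.real.
  by apply: ger0_real; apply: le_trans (fM x).
by rewrite (le_trans (fM x)) // (le_trans (real_ler_norm MxE)) // normrM normr_id.
Unshelve. all: by end_near. Qed.

End LinearMaps.

(** * Geometry of a Hilbert space *)

Section Hilbert.
Variables (R : realType) (K : numFieldType) (theta : K -> K).
Hypothesis hK : scalar_field R theta.
Variables (H : completeNormedModType K) (dot : {dot H for theta}).
Hypothesis hH : hilbert_space dot.
Implicit Types x y z u v : H.

Lemma dotDl x y z : dot (x + y) z = dot x z + dot y z.
Proof. exact: linearDl. Qed.
Lemma dotBl x y z : dot (x - y) z = dot x z - dot y z.
Proof. exact: linearBl. Qed.
Lemma dotZl a x z : dot (a *: x) z = a * dot x z.
Proof. exact: linearZl_LR. Qed.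
Lemma dot0l z : dot 0 z = 0.
Proof. exact: linear0l. Qed.
Lemma dot_suml (I : Type) (r : seq I) (F : I -> H) z :
  dot (\sum_(i <- r) F i) z = \sum_(i <- r) dot (F i) z.
Proof. exact: linear_sumlz. Qed.
Lemma dotDr z x y : dot z (x + y) = dot z x + dot z y.
Proof. exact: linearDr. Qed.
Lemma dotBr z x y : dot z (x - y) = dot z x - dot z y.
Proof. exact: linearBr. Qed.
Lemma dotZr a z x : dot z (a *: x) = theta a * dot z x.
Proof. exact: linearZr_LR. Qed.
Lemma dot0r z : dot z 0 = 0.
Proof. exact: linear0r. Qed.
Lemma dot_sumr (I : Type) (r : seq I) (F : I -> H) z :
  dot z (\sum_(i <- r) F i) = \sum_(i <- r) dot z (F i).
Proof. exact: linear_sumr. Qed.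
Lemma dotC x y : dot x y = theta (dot y x).
Proof. by rewrite [LHS]hermitian_subproof expr0 mul1r. Qed.

Lemma dot_eq0C x y : dot x y = 0 -> dot y x = 0.
Proof. by move=> xy; rewrite dotC xy (scalar_conj_nneg hK). Qed.

Lemma dot_ext z z' : (forall x, dot x z = dot x z') -> z = z'.
Proof.
move=> h; apply/eqP; rewrite -subr_eq0 -normr_eq0 -sqrf_eq0 hH.
by rewrite dotBr h subrr.
Qed.

Lemma pythagoras u v : dot u v = 0 -> `|u + v| ^+ 2 = `|u| ^+ 2 + `|v| ^+ 2.
Proof.
by move=> uv; rewrite !hH dotDl !dotDr uv (dot_eq0C uv) addr0 add0r.
Qed.

Lemma parallelogram u v :
  `|u + v| ^+ 2 + `|u - v| ^+ 2 = 2 * `|u| ^+ 2 + 2 * `|v| ^+ 2.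
Proof. by rewrite !hH dotDl dotBl !dotBr !dotDr; ring. Qed.

(** Projection onto the line spanned by [y]. Both the Cauchy-Schwarz inequality
    and the orthogonality of a best approximation are read off from it. *)
Lemma line_residual x y : y != 0 -> let c := dot x y / `|y| ^+ 2 in
  dot (x - c *: y) y = 0 /\
  `|x| ^+ 2 = `|x - c *: y| ^+ 2 + `|dot x y| ^+ 2 / `|y| ^+ 2.
Proof.
move=> y0 c; have ny0 : `|y| ^+ 2 != 0 by rewrite sqrf_eq0 normr_eq0.
have cy : dot (x - c *: y) y = 0 by rewrite dotBl dotZl -hH divfK ?subrr.
split=> //; rewrite -[in LHS](subrK (c *: y) x) [in LHS]pythagoras; last first.
  by rewrite dotZr cy mulr0.
congr (_ + _); rewrite normrZ exprMn normrM normfV normrX normr_id.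
by field; rewrite normr_eq0.
Qed.

Lemma cauchy_schwarz x y : `|dot x y| ^+ 2 <= `|x| ^+ 2 * `|y| ^+ 2.
Proof.
have [->|y0] := eqVneq y 0; first by rewrite dot0r !normr0 expr0n mulr0.
have [_ /= ->] := line_residual x y0.
rewrite mulrDl divfK ?sqrf_eq0 ?normr_eq0 // lerDr.
by rewrite mulr_ge0 // exprn_ge0.
Qed.

Lemma cauchy_schwarz_norm x y : `|dot x y| <= `|x| * `|y|.
Proof. by rewrite -ler_sqr ?nnegrE ?mulr_ge0 // exprMn cauchy_schwarz. Qed.

Lemma dot_bundle y : exists2 L : {linear H -> K^o},
  (L : H -> K^o) = (fun x => dot x y) & continuous L.
Proof.
have [|L LE] := @linear_bundle K H K^o (fun x => dot x y).
  by move=> a u v; rewrite dotDl dotZl.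
exists L => //; apply: (@bounded_by_continuous _ _ _ L `|y|) => x.
by rewrite LE mulrC cauchy_schwarz_norm.
Qed.

Lemma cvg_sum_dot (I : choiceType) (x : I -> H) (l y : H) :
  partial_sum x @ totally --> l ->
  partial_sum ((fun i => dot (x i) y) : I -> K^o) @ totally --> (dot l y : K^o).
Proof.
move=> xl; have [L LE LC] := dot_bundle y.
by have := cvg_sum_linear LC xl; rewrite LE.
Qed.

Lemma closed_orth y : closed [set x | dot x y = 0].
Proof.
have [L LE LC] := dot_bundle y.
have -> : [set x | dot x y = 0] = L @^-1` [set 0].
  by apply/seteqP; split=> x /=; rewrite LE.
apply: preimage_closed => [x _|]; first exact: LC.
apply: compact_closed; [exact: norm_hausdorff|exact: compact_set1].
Qed.

Lemma linear_subspace_orth y : linear_subspace [set x | dot x y = 0].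
Proof.
split=> [|a u v /= u0 v0]; first exact: dot0l.
by rewrite dotDl dotZl u0 v0 mulr0 addr0.
Qed.

(** * Orthogonal projections *)

(** By the parallelogram identity, almost minimizing vectors of [V] are close
    to each other, so they form a Cauchy filter, whose limit is a minimizer. *)
Lemma best_approximation (V : set H) (f : H) : closed_subspace V ->
  exists2 p, V p & forall v, V v -> `|f - p| ^+ 2 <= `|f - v| ^+ 2.
Proof.
move=> [[V0 Vlin] Vcl].
(* The infimum [d] of the squared distances is the supremum of their lower
   bounds. *)
pose A := [set a : K | 0 <= a /\ forall v, V v -> a <= `|f - v| ^+ 2].
have sq0 (x : H) : 0 <= `|x| ^+ 2 by rewrite exprn_ge0.
have [||d dA dm] := @scalar_sup _ _ _ hK A (`|f - 0| ^+ 2).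
- by exists 0; split.
- by move=> a [a0 /(_ _ V0) ->]; rewrite a0.
have dV v : V v -> d <= `|f - v| ^+ 2 by move=> Vv; apply: dm => // a [_]; exact.
have d0 : 0 <= d by apply: dA; split.
have dE e : 0 < e -> exists2 v, V v & `|f - v| ^+ 2 < d + e.
  move=> e0; apply: contrapT => hn; have : A (d + e).
    split=> [|v Vv]; first by rewrite addr_ge0 // ltW.
    rewrite real_leNgt; last by rewrite ger0_real.
      by apply/negP => h; apply: hn; exists v.
    by rewrite ger0_real // addr_ge0 // ltW.
  by move=> /dA; rewrite gerDl => /(lt_le_trans e0); rewrite ltxx.
pose B (e : K) := [set v | V v /\ `|f - v| ^+ 2 < d + e].
pose F := filter_from [set e : K | 0 < e] B.
have BS e e' : e <= e' -> B e `<=` B e'.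
  by move=> ee' v [Vv h]; split=> //; rewrite (lt_le_trans h) // lerD2l.
have FF : ProperFilter F.
  apply: filter_from_proper; last by move=> e /dE [v Vv h]; exists v; split.
  apply: filter_from_filter; first by exists 1 => /=.
  move=> e e' /= e0 e'0.
  have /orP[ee'|ee'] := real_leVge (gtr0_real e0) (gtr0_real e'0).
    by exists e => // v Bv; split=> //; exact: BS Bv.
  by exists e' => // v Bv; split=> //; exact: BS Bv.
have Bclose e v v' : B e v -> B e v' -> `|v - v'| ^+ 2 < 4 * e.
  move=> [Vv hv] [Vv' hv'].
  (* The midpoint is in [V], so its distance to [f] is also at least [d]. *)
  have Vm : V (2^-1 *: v + 2^-1 *: v').
    by apply: (Vlin) => //; rewrite -[_ *: v']addr0; apply: Vlin.
  have E : `|v - v'| ^+ 2 = 2 * `|f - v| ^+ 2 + 2 * `|f - v'| ^+ 2 -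
      4 * `|f - (2^-1 *: v + 2^-1 *: v')| ^+ 2.
    have -> : v - v' = (f - v') - (f - v).
      by rewrite opprB [RHS]addrC addrA subrK.
    have := parallelogram (f - v') (f - v) => /(canRL (addKr _)) ->.
    rewrite addrC [2 * _ + 2 * _]addrC; congr (_ - _).
    have -> : f - v' + (f - v) = 2 *: (f - (2^-1 *: v + 2^-1 *: v')).
      rewrite scalerBr scalerDr !scalerA mulfV ?pnatr_eq0 // !scale1r.
      by rewrite scaler_nat mulr2n opprD addrACA [- v' - v]addrC.
    by rewrite normrZ exprMn ger0_norm //; congr (_ * _); ring.
  rewrite E ltrBlDr.
  have -> : 4 * e + 4 * `|f - (2^-1 *: v + 2^-1 *: v')| ^+ 2 =
     2 * (e + `|f - (2^-1 *: v + 2^-1 *: v')| ^+ 2)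
     + 2 * (e + `|f - (2^-1 *: v + 2^-1 *: v')| ^+ 2) by ring.
  have dm' := dV _ Vm.
  rewrite ltrD // ltr_pM2l //; last 1 first.
  - by rewrite (lt_le_trans hv') // addrC lerD2l.
  - by rewrite (lt_le_trans hv) // addrC lerD2l.
have /cauchy_cvg : cauchy F.
  apply: cauchy_exP => e e0.
  have e4 : 0 < e ^+ 2 / 4 by rewrite divr_gt0 ?exprn_gt0.
  have [v Vv hv] := dE _ e4; exists v, (e ^+ 2 / 4) => // v' Bv'.
  rewrite -ball_normE /ball_ /= -ltr_sqr ?nnegrE ?(ltW e0) //.
  have := @Bclose _ v v' (conj Vv hv) Bv'.
  by rewrite mulrC divfK ?pnatr_eq0.
move=> /cvg_ex [p Fp]; exists p.
  apply: Vcl => C /Fp FC.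
  have : F (V `&` C).
    apply: filterI => //; exists 1 => //= v; by case.
  by move=> /filter_ex.
move=> v Vv; apply: le_trans (dV _ Vv).
rewrite real_leNgt ?ger0_real //; apply/negP => dp.
have : (fun v => `|f - v| * `|f - v|) @ F --> `|f - p| * `|f - p|.
  by apply: cvgM; apply: cvg_norm; apply: cvgB => //; exact: cvg_cst.
move=> /cvgrPdist_lt /(_ ((`|f - p| ^+ 2 - d) / 2)).
have e0 : 0 < (`|f - p| ^+ 2 - d) / 2 by rewrite divr_gt0 // subr_gt0.
move=> /(_ e0) FC.
have FB : F (B ((`|f - p| ^+ 2 - d) / 2)) by exists ((`|f - p| ^+ 2 - d) / 2).
have [v' [/= h1 [_ h2]]] := filter_ex (filterI FC FB).
move: h1; rewrite -!expr2 => /(le_lt_trans (real_ler_norm _)).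
rewrite realB ?ger0_real // => /(_ isT); rewrite ltrBlDr => /lt_trans.
have h3 : (`|f - p| ^+ 2 - d) / 2 + `|f - v'| ^+ 2 < `|f - p| ^+ 2.
  rewrite -ltrBrDl (lt_le_trans h2) // le_eqVlt; apply/orP; left; apply/eqP.
  by field.
by move=> /(_ _ h3); rewrite ltxx.
Qed.

(** Moving a best approximation [p] of [f] along [v] would decrease the distance
    by the term that [line_residual] provides, unless [f - p] is orthogonal to
    [v]. *)
Lemma orthproj_exists (V : set H) (f : H) : closed_subspace V ->
  exists p, V p /\ forall v, V v -> dot (f - p) v = 0.
Proof.
move=> hV; have [p Vp pmin] := best_approximation f hV.
exists p; split=> // v Vv.
have [->|v0] := eqVneq v 0; first by rewrite dot0r.
have [_ /=] := line_residual (f - p) v0.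
set c := _ / _ => E.
have Vc : V (c *: v + p) by apply: (proj2 (proj1 hV)).
have := pmin _ Vc; rewrite E opprD addrA [f - _ - _]addrAC gerDl.
rewrite pmulr_lle0 ?invr_gt0 ?exprn_gt0 ?normr_gt0 // => h.
by apply/eqP; rewrite -normr_eq0 -sqrf_eq0 eq_le h exprn_ge0.
Qed.

Lemma orthproj_spec (V : set H) (f : H) : closed_subspace V ->
  V (orthproj dot V f) /\ forall v, V v -> dot (f - orthproj dot V f) v = 0.
Proof. by move=> /(orthproj_exists f) /(xgetPex 0). Qed.

End Hilbert.

(** * Bounded operators and their adjoints *)

Section Operators.
Variables (R : realType) (K : numFieldType) (theta : K -> K).
Hypothesis hK : scalar_field R theta.
Variables (H : completeNormedModType K) (dot : {dot H for theta}).
Hypothesis hH : hilbert_space dot.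
Implicit Types x y z u v : H.

Lemma bounded_op_bundle (T : H -> H) : bounded_op T ->
  exists2 L : {linear H -> H}, (L : H -> H) = T &
    exists2 M : K, 0 < M & forall x, `|L x| <= M * `|x|.
Proof.
move=> [/linear_bundle [L <-] [M hM]]; exists L => //.
(* Over the zero space [M] may have any sign, or fail to be real. *)
exists (`|M| + 1) => [|x]; first by rewrite ltr_wpDl.
rewrite mulrDl mul1r (le_trans (hM x)) //.
have Mx : M * `|x| \is Num.real by apply: ger0_real; apply: le_trans (hM x).
by rewrite (le_trans (real_ler_norm Mx)) // normrM normr_id lerDl.
Qed.

Lemma bounded_op_continuous (T : H -> H) : bounded_op T -> continuous T.
Proof.
by move=> /bounded_op_bundle [L <- [M _ hM]]; exact: bounded_by_continuous hM.
Qed.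

Lemma bounded_op_comp (T T' : H -> H) :
  bounded_op T -> bounded_op T' -> bounded_op (T \o T').
Proof.
move=> /bounded_op_bundle [L <- [M M0 hM]] /bounded_op_bundle [L' <- [M' _ hM']].
split=> [a x y|]; first by rewrite /= !linearP.
exists (M * M') => x /=; rewrite (le_trans (hM _)) // -mulrA.
by rewrite ler_pM2l.
Qed.

Lemma invertible_op_comp (T T' : H -> H) :
  invertible_op T -> invertible_op T' -> invertible_op (T \o T').
Proof.
move=> [bT [X [bX TX XT]]] [bT' [X' [bX' TX' XT']]].
split; first exact: bounded_op_comp.
exists (X' \o X); split; first exact: bounded_op_comp.
- exact: can_comp TX TX'.
- exact: can_comp XT' XT.
Qed.

Lemma inverse_op_eq (T T' : H -> H) :
  cancel T T' -> cancel T' T -> inverse_op T = T'.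
Proof.
move=> TT' T'T; apply/funext => y.
apply: (can_inj TT'); rewrite T'T; apply: pinvK.
by rewrite inE; exists (T' y).
Qed.

Lemma inverse_op_spec (T : H -> H) : invertible_op T ->
  [/\ invertible_op (inverse_op T), cancel T (inverse_op T) &
      cancel (inverse_op T) T].
Proof.
move=> [bT [T' [bT' TT' T'T]]]; rewrite (inverse_op_eq TT' T'T).
by split=> //; split=> //; exists T.
Qed.

Lemma bounded_below_invertible (T : H -> H) (c : K) : bounded_op T -> 0 < c ->
  (forall x, c * `|x| <= `|T x|) -> (forall y, exists x, T x = y) ->
  invertible_op T.
Proof.
move=> bT c0 cT surjT; split=> //.
have [L LT _] := bounded_op_bundle bT; rewrite -LT in cT surjT *.
have injL : injective L.
  move=> x y xy; apply/eqP; rewrite -subr_eq0 -normr_eq0 eq_le normr_ge0 andbT.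
  by rewrite -(pmulr_rle0 _ c0) (le_trans (cT _)) // linearB xy subrr normr0.
have [X LX] := choice surjT.
have XL : cancel L X by move=> x; apply: injL; rewrite LX.
exists X; split=> //; split=> [a x y|]; first by apply: injL; rewrite linearP !LX.
exists c^-1 => x; rewrite -(ler_pM2l c0) mulrA divff ?gt_eqF // mul1r.
by rewrite -[in leRHS](LX x).
Qed.

(** The preimages of the balls around a limit point [y] of the range are a base
    of a Cauchy filter, since [T] expands distances by at least [c]; its limit is
    a preimage of [y]. *)
Lemma bounded_below_closed_range (T : H -> H) (c : K) : bounded_op T -> 0 < c ->
  (forall x, c * `|x| <= `|T x|) -> closed_subspace (range T).
Proof.
move=> bT c0 cT; have TC := bounded_op_continuous bT.
have [L LT _] := bounded_op_bundle bT; rewrite -LT in cT TC *.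
split; first split; first by exists 0; rewrite ?linear0.
  by move=> a _ _ [x _ <-] [y _ <-]; exists (a *: x + y); rewrite ?linearP.
move=> y ycl; pose B (e : K) := [set x | `|y - L x| < e].
pose F := filter_from [set e : K | 0 < e] B.
have FF : ProperFilter F.
  apply: filter_from_proper; last first.
    move=> e /= e0; have [_ [[x _ <-] yx]] := ycl _ (nbhsx_ballx y _ e0).
    by exists x; move: yx; rewrite -ball_normE.
  apply: filter_from_filter; first by exists 1 => /=.
  move=> e e' /= e0 e'0.
  have /orP[ee'|ee'] := real_leVge (gtr0_real e0) (gtr0_real e'0).
    by exists e => // x Bx; split=> //; exact: lt_le_trans ee'.
  by exists e' => // x Bx; split=> //; exact: lt_le_trans ee'.
have /cauchy_cvg /cvg_ex [x Fx] : cauchy F.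
  apply: cauchy_exP => e e0; have e2 : 0 < c * e / 2 by rewrite divr_gt0 ?mulr_gt0.
  have FB : F (B (c * e / 2)) by exists (c * e / 2).
  have [x0 Bx0] := filter_ex FB.
  exists x0, (c * e / 2) => // x Bx; rewrite -ball_normE /ball_ /=.
  rewrite -(ltr_pM2l c0) (le_lt_trans (cT _)) // linearB.
  have -> : L x0 - L x = (y - L x) - (y - L x0).
    by rewrite opprB [RHS]addrC addrA subrK.
  by rewrite (le_lt_trans (ler_normB _ _)) // [ltRHS]splitr ltrD.
exists x => //; apply: (@cvg_unique _ (@norm_hausdorff _ H) (L @ F)).
  exact: continuous_cvg (TC x) _.
apply/cvgrPdist_lt => e e0; exists e => //.
Qed.

(** The Riesz representation of the functional [x |-> <T x, y>]: it vanishes or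
    its kernel has a nonzero normal vector [u], a multiple of which
    represents it. *)
Lemma riesz_adjoint (T : H -> H) y : bounded_op T ->
  exists z, forall x, dot (T x) y = dot x z.
Proof.
move=> bT; have TC := bounded_op_continuous bT.
have [L LT _] := bounded_op_bundle bT; rewrite -LT in TC *.
pose V := [set x | dot (L x) y = 0].
have hV : closed_subspace V.
  split.
  2: apply: (@preimage_closed _ _ L [set x | dot x y = 0]) => [x _|];
       [exact: TC|exact: (@closed_orth _ _ _ hK _ _ hH y)].
  split; rewrite /V /= ?linear0 ?dot0l // => a u v u0 v0.
  by rewrite linearP dotDl dotZl u0 v0 mulr0 addr0.
have [V1|/existsNP [x0 Vx0]] := pselect (forall x, V x).
  by exists 0 => x; rewrite dot0r; exact: V1.
have [Vp up] := orthproj_spec hK hH x0 hV.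
set u := _ - _ in up.
have Lu : dot (L u) y != 0.
  by rewrite linearB dotBl (Vp : dot _ _ = 0) subr0; apply/eqP.
have u0 : u != 0 by apply: contraNneq Lu => ->; rewrite linear0 dot0l.
have nu0 : `|u| ^+ 2 != 0 by rewrite sqrf_eq0 normr_eq0.
exists ((theta (dot (L u) y) / `|u| ^+ 2) *: u) => x.
have Vx : V (x - (dot (L x) y / dot (L u) y) *: u).
  by rewrite /V /= linearB linearZ /= dotBl dotZl divfK ?subrr.
have := dot_eq0C hK (up _ Vx); rewrite dotBl dotZl => /(canRL (subrK _)).
rewrite add0r dotZr => ->; rewrite (scalar_conjM hK) (scalar_conjK hK).
rewrite (@scalar_conj_nneg _ _ _ hK _^-1) ?invr_ge0 ?exprn_ge0 // -hH.
by field; rewrite normr_eq0 u0 Lu.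
Qed.

Lemma adjoint_spec (T : H -> H) : bounded_op T ->
  forall x y, dot (T x) y = dot x (adjoint dot T y).
Proof. by move=> bT x y; exact: (xgetPex 0 (riesz_adjoint y bT)). Qed.

(** [|T^* y|^2 = <T T^* y, y> <= M |T^* y| |y|], and one factor [|T^* y|]
    cancels. *)
Lemma bounded_op_adjoint (T : H -> H) : bounded_op T -> bounded_op (adjoint dot T).
Proof.
move=> bT; have aT := adjoint_spec bT.
have [L LT [M M0 hM]] := bounded_op_bundle bT; rewrite -LT in aT *.
split=> [a x y|].
  by apply: (dot_ext hH) => z; rewrite dotDr dotZr -!aT dotDr dotZr.
exists M => y; set Ty := adjoint _ _ _.
have [->|Ty0] := eqVneq Ty 0; first by rewrite normr0 mulr_ge0 // ltW.
rewrite -(@ler_pM2r _ `|Ty|) ?normr_gt0 // -expr2 hH -aT.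
have h0 : 0 <= dot (L Ty) y by rewrite aT -hH exprn_ge0.
rewrite -(ger0_norm h0) (le_trans (cauchy_schwarz_norm hK hH _ _)) //.
by rewrite mulrAC ler_wpM2r.
Qed.

Lemma invertible_op_adjoint (T : H -> H) :
  invertible_op T -> invertible_op (adjoint dot T).
Proof.
move=> [bT [X [bX TX XT]]]; split; first exact: bounded_op_adjoint.
exists (adjoint dot X); split; first exact: bounded_op_adjoint.
- by move=> y; apply: (dot_ext hH) => x; rewrite -!adjoint_spec // XT.
- by move=> y; apply: (dot_ext hH) => x; rewrite -!adjoint_spec // TX.
Qed.

Lemma adjoint_eq (T T' : H -> H) : bounded_op T ->
  (forall x y, dot (T x) y = dot x (T' y)) -> adjoint dot T = T'.
Proof.
move=> bT h; apply/funext => y; apply: (dot_ext hH) => x.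
by rewrite -adjoint_spec.
Qed.

Lemma image_cancel (T T' : H -> H) (V : set H) :
  cancel T T' -> cancel T' T -> T @` V = T' @^-1` V.
Proof.
move=> TT' T'T; apply/seteqP; split=> x /=.
  by move=> [v Vv <-]; rewrite TT'.
by move=> Vx; exists (T' x).
Qed.

Lemma closed_subspace_preimage (T : H -> H) (V : set H) :
  bounded_op T -> closed_subspace V -> closed_subspace (T @^-1` V).
Proof.
move=> bT [[V0 Vlin] Vcl]; have TC := bounded_op_continuous bT.
have [L LT _] := bounded_op_bundle bT; rewrite -LT in TC *.
split; last by apply: preimage_closed => // x _; exact: TC.
split=> [|a x y]; rewrite /preimage /= ?linear0 // linearP; exact: Vlin.
Qed.

End Operators.

(** * Fusion Riesz bases and their frame operators *)

Section Riesz.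
Variables (R : realType) (K : numFieldType) (theta : K -> K).
Hypothesis hK : scalar_field R theta.
Variables (H : completeNormedModType K) (dot : {dot H for theta}).
Hypothesis hH : hilbert_space dot.
Variable I : countType.
Implicit Types (W : I -> set H) (w : I -> K) (x y z f g : H).

Let cs_norm := cauchy_schwarz_norm hK hH.

Lemma cvg_sum_dotr (x : I -> H) (l y : H) :
  partial_sum x @ totally --> l ->
  partial_sum ((fun i => dot y (x i)) : I -> K^o) @ totally --> (dot y l : K^o).
Proof.
move=> /cvg_sumP h; apply/cvg_sumP => e e0.
(* Adding 1 avoids a division by zero when [y = 0]. *)
have y1 : 0 < `|y| + 1 by rewrite ltr_wpDl.
have [|J0 hJ0] := h (e / (`|y| + 1)); first by rewrite divr_gt0.
exists J0 => J /hJ0; rewrite ltr_pdivlMr // => hJ.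
rewrite -dot_sumr -dotBr (le_lt_trans (cs_norm _ _)) //.
by rewrite (le_lt_trans _ hJ) // mulrC ler_wpM2l // lerDl.
Qed.

(** The Riesz bounds speak of finite weighted sums with one vector from each
    subspace; these sums already form a subspace, hence exhaust the span. *)
Lemma span_finite_sums W w : (forall i, linear_subspace (W i)) -> weights w ->
  smallest (@linear_subspace K H) (\bigcup_i W i) `<=`
  [set x | exists J : {fset I}, exists f : I -> H, (forall i, W i (f i)) /\
     x = \sum_(j <- J) w j *: f j].
Proof.
move=> hW w0; apply: smallest_sub; last first.
  move=> x [i _ Wx]; exists [fset i]%fset.
  exists (fun j => if j == i then (w i)^-1 *: x else 0); split.
    move=> j; case: eqP => [->|_]; last exact: (hW j).1.
    by rewrite -[_ *: x]addr0; apply: (hW i).2 => //; exact: (hW i).1.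
  by rewrite big_seq_fset1 eqxx scalerA divff ?gt_eqF // scale1r.
split.
  by exists fset0, (fun=> 0); split=> [i|]; [exact: (hW i).1|rewrite big_seq_fset0].
move=> a _ _ [J [f [Wf ->]]] [J' [f' [Wf' ->]]].
(* Truncating the two families to their index sets lets both sums run over
   the union. *)
pose r (A : {fset I}) (h : I -> H) i := if i \in A then h i else 0.
have rE (A : {fset I}) h : (A `<=` J `|` J')%fset ->
    \sum_(j <- A) w j *: h j = \sum_(j <- (J `|` J')%fset) w j *: r A h j.
  move=> AJ; rewrite -(big_fset_incl _ AJ) => [|i _ /negbTE iA]; last first.
    by rewrite /r iA scaler0.
  by rewrite big_seq [RHS]big_seq; apply: eq_bigr => i iA; rewrite /r iA.
have rW (A : {fset I}) h i : (forall i, W i (h i)) -> W i (r A h i).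
  by move=> Wh; rewrite /r; case: ifP => // _; exact: (hW i).1.
exists (J `|` J')%fset, (fun i => a *: r J f i + r J' f' i); split.
  by move=> i; apply: (hW i).2; exact: rW.
rewrite (rE J f (fsubsetUl _ _)) (rE J' f' (fsubsetUr _ _)) scaler_sumr -big_split.
by apply: eq_bigr => i _; rewrite /= scalerDr !scalerA mulrC.
Qed.

Lemma complete_orth_eq0 W f : closed_span (\bigcup_i W i) = [set: H] ->
  (forall i x, W i x -> dot x f = 0) -> f = 0.
Proof.
move=> hc hf; apply/eqP; rewrite -normr_eq0 -sqrf_eq0 hH; apply/eqP.
have : closed_span (\bigcup_i W i) f by rewrite hc.
have cl : closed [set x | dot x f = 0] by exact: (@closed_orth _ _ _ hK _ _ hH f).
have sub : smallest (@linear_subspace K H) (\bigcup_i W i) `<=` [set x | dot x f = 0].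
  by apply: smallest_sub; [exact: linear_subspace_orth|move=> x [i _ /hf]].
by move=> /(closureS sub) /cl.
Qed.

Section Projections.
Variable V : set H.
Hypothesis hV : closed_subspace V.
Local Notation pr := (orthproj dot V).

Lemma orthproj_in f : V (pr f).
Proof. exact: (orthproj_spec hK hH f hV).1. Qed.

Lemma dot_orthprojr f v : V v -> dot (pr f) v = dot f v.
Proof.
move=> Vv; apply/eqP; rewrite eq_sym -subr_eq0 -dotBl.
by rewrite (orthproj_spec hK hH f hV).2.
Qed.

Lemma dot_orthprojl f v : V v -> dot v (pr f) = dot v f.
Proof. by move=> Vv; rewrite [LHS]dotC dot_orthprojr // -dotC. Qed.

Lemma dot_orthproj_self f : dot (pr f) f = `|pr f| ^+ 2.
Proof. by rewrite -dot_orthprojl ?hH //; exact: orthproj_in. Qed.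

Lemma orthproj_id v : V v -> pr v = v.
Proof.
move=> Vv; apply: (dot_ext hH) => x.
apply/eqP; rewrite -subr_eq0 -dotBr; apply/eqP.
have Vp : V (pr v - v).
  by rewrite addrC -scaleN1r; apply: hV.1.2 => //; exact: orthproj_in.
have h : `|pr v - v| ^+ 2 = 0 by rewrite hH dotBl dot_orthprojr // subrr.
by move/eqP: h; rewrite sqrf_eq0 normr_eq0 => /eqP ->; rewrite dot0r.
Qed.

Lemma orthproj_eq0 f : (forall v, V v -> dot f v = 0) -> pr f = 0.
Proof.
move=> h; apply/eqP; rewrite -normr_eq0 -sqrf_eq0 hH dot_orthprojr ?h //;
exact: orthproj_in.
Qed.

End Projections.

Section FrameOperator.
Variables (W : I -> set H) (w : I -> K) (C D : K).
Hypotheses (hW : weighted_subspaces W w)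
  (hc : closed_span (\bigcup_i W i) = [set: H]) (C0 : 0 < C) (D0 : 0 < D).
Hypothesis hCD : forall (J : {fset I}) (f : I -> H),
  (forall j, j \in J -> W j (f j)) ->
  C * (\sum_(j <- J) `|f j| ^+ 2) <= `|\sum_(j <- J) w j *: f j| ^+ 2
  /\ `|\sum_(j <- J) w j *: f j| ^+ 2 <= D * (\sum_(j <- J) `|f j| ^+ 2).

Let p i f := orthproj dot (W i) f.
Let S := frame_operator dot W w.
Let t f i := w i ^+ 2 * `|p i f| ^+ 2.
Let Wp i f : W i (p i f). Proof. exact: orthproj_in (hW.1 i) f. Qed.
Let w0 i : w i != 0. Proof. by rewrite gt_eqF // hW.2. Qed.

Let Ws i a x : W i x -> W i (a *: x).
Proof.
by move=> Wx; rewrite -[_ *: x]addr0; apply: (hW.1 i).1.2 => //; exact: (hW.1 i).1.1.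
Qed.

Let t_ge0 f i : 0 <= t f i. Proof. by rewrite mulr_ge0 // exprn_ge0 // ltW ?hW.2. Qed.

Let tE f i : t f i = `|w i *: p i f| ^+ 2.
Proof. by rewrite normrZ exprMn ger0_norm // ltW ?hW.2. Qed.

(** The upper Riesz bound applied to the vectors [w_j pi_j f]. *)
Lemma frame_sum_upper f (J : {fset I}) :
  `|\sum_(j <- J) w j ^+ 2 *: p j f| ^+ 2 <= D * \sum_(j <- J) t f j.
Proof.
have [|_] := @hCD J (fun j => w j *: p j f); first by move=> j _; exact: Ws.
under eq_bigr do rewrite scalerA -expr2.
by under [X in _ <= _ * X]eq_bigr do rewrite -tE.
Qed.

(** If [Y] is the sum on the left, then [Y = <sum_j w_j^2 pi_j f, f>], so
    Cauchy-Schwarz and [frame_sum_upper] give [Y^2 <= D Y |f|^2]. *)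
Lemma frame_upper f (J : {fset I}) : \sum_(j <- J) t f j <= D * `|f| ^+ 2.
Proof.
set Y := \sum_(j <- J) t f j.
have Y0 : 0 <= Y by exact: sumr_ge0.
have YE : dot (\sum_(j <- J) w j ^+ 2 *: p j f) f = Y.
  rewrite dot_suml; apply: eq_bigr => j _.
  by rewrite dotZl dot_orthproj_self //; exact: hW.1.
have [->|Yn0] := eqVneq Y 0; first by rewrite mulr_ge0 ?exprn_ge0 // ltW.
have Yp : 0 < Y by rewrite lt_def Yn0.
rewrite -(ler_pM2l Yp) -expr2 -{1}(ger0_norm Y0) -{1}YE.
rewrite (le_trans (cauchy_schwarz hK hH _ _)) // [leRHS]mulrCA [leRHS]mulrA.
by rewrite ler_wpM2r ?exprn_ge0 // frame_sum_upper.
Qed.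

(** The scalars [w_i^2 |pi_i f|^2] are summable, and [frame_sum_upper] bounds
    the tails of the vector series by the tails of the scalar one. *)
Lemma frame_operator_cvg f :
  partial_sum (fun i => w i ^+ 2 *: p i f) @ totally --> S f.
Proof.
have FF : ProperFilter (@totally I) by exact: totally_filter.
have [l l0 tl] := cvg_nneg_sum hK (t_ge0 f) (frame_upper f).
apply: (cauchy_cvg (partial_sum (fun i => w i ^+ 2 *: p i f) @ totally)).
apply: cauchy_exP => e e0; move/cvg_sumP: (tl).
have d0 : 0 < e ^+ 2 / D by rewrite divr_gt0 ?exprn_gt0.
move=> /(_ _ d0) [J0 hJ0].
exists (partial_sum (fun i => w i ^+ 2 *: p i f) J0), J0 => // J /= J0J.
rewrite -ball_normE /ball_ /= !partial_sumE (big_fset_split _ J0J) opprD addrA.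
rewrite subrr add0r normrN -ltr_sqr ?nnegrE ?(ltW e0) //.
rewrite (le_lt_trans (frame_sum_upper _ _)) // mulrC -ltr_pdivlMr //.
apply: le_lt_trans (hJ0 _ (fsubset_refl _)).
apply: le_trans (real_ler_norm _); last first.
  by rewrite realB ?ger0_real //; apply: sumr_ge0.
rewrite lerBrDl -big_fset_split //.
by apply: cvg_nneg_sum_ge tl => //; exact: ger0_real.
Qed.

Lemma frame_form_cvg f :
  partial_sum (t f : I -> K^o) @ totally --> (dot (S f) f : K^o).
Proof.
rewrite (_ : t f = fun i => dot (w i ^+ 2 *: p i f) f).
  exact: (cvg_sum_dot hK hH (y := f) (@frame_operator_cvg f)).
by apply/funext => i; rewrite dotZl dot_orthproj_self //; exact: hW.1.
Qed.

Lemma frame_form_ge0 f : 0 <= dot (S f) f.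
Proof.
have [l l0 tl] := cvg_nneg_sum hK (t_ge0 f) (frame_upper f).
by rewrite (cvg_sum_unique (@frame_form_cvg f) tl).
Qed.

Lemma frame_form_partial f (J : {fset I}) : \sum_(j <- J) t f j <= dot (S f) f.
Proof.
apply: cvg_nneg_sum_ge (@frame_form_cvg f) => //.
by apply: ger0_real; exact: frame_form_ge0.
Qed.

(** For a finite sum [x] of vectors [w_j h_j], the Cauchy-Schwarz inequality
    and the lower Riesz bound give [C |<x, f>|^2 <= |x|^2 <S f, f>]. Both sides
    are continuous in [x] and such sums are dense, so [x = f] is allowed. *)
Lemma frame_form_lower f : C * `|f| ^+ 2 <= dot (S f) f.
Proof.
set q := dot (S f) f; have q0 : 0 <= q by exact: frame_form_ge0.
pose g (x : H) := `|x| * `|x| * q - C * (`|dot x f| * `|dot x f|).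
have gr x : g x \is Num.real.
  by rewrite realB ?ger0_real ?mulr_ge0 // ltW.
have gC : continuous (g : H -> K^o).
  have [L LE LC] := dot_bundle hK hH f.
  have dC x : (fun x => `|dot x f| : K^o) @ x --> (`|dot x f| : K^o).
    have := cvg_norm (LC x); rewrite LE; exact.
  move=> x; apply: (@cvgB K K^o).
    apply: (@cvgM K); last exact: cvg_cst.
    by apply: (@cvgM K); exact: norm_continuous.
  apply: (@cvgM K); first exact: cvg_cst.
  by apply: (@cvgM K); exact: dC.
have : [set x | 0 <= g x] f.
  have : closed_span (\bigcup_i W i) f by rewrite hc.
  have cl : closed [set x | 0 <= g x] by exact: closed_nneg.
  have sub : smallest (@linear_subspace K H) (\bigcup_i W i) `<=` [set x | 0 <= g x].
    move=> x /(span_finite_sums (fun i => (hW.1 i).1) hW.2) [J [h [Wh ->]]] /=.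
    rewrite subr_ge0 -!expr2.
    have -> : dot (\sum_(j <- J) w j *: h j) f = \sum_(j <- J) dot (h j) (w j *: p j f).
      rewrite dot_suml; apply: eq_bigr => j _.
      rewrite dotZl dotZr dot_orthprojl ?(scalar_conj_nneg hK) //; last exact: hW.1.
      by rewrite ltW ?hW.2.
    have [//|hC _] := @hCD J h.
    apply: le_trans (ler_wpM2r (@frame_form_ge0 f) hC); rewrite -mulrA ler_pM2l //.
    apply: le_trans (ler_wpM2l _ (@frame_form_partial f J)); last first.
      by apply: sumr_ge0 => j _; exact: exprn_ge0.
    under [X in _ <= _ * X]eq_bigr do rewrite tE.
    apply: le_trans (cauchy_schwarz_sum J _ _) => //.
    rewrite ler_sqr ?nnegrE ?sumr_ge0 //.
    by rewrite (le_trans (ler_norm_sum _ _ _)) // ler_sum // => j _; exact: cs_norm.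
  by move=> /(closureS sub) /cl.
rewrite /= subr_ge0 -!expr2 -hH.
have [->|f0] := eqVneq f 0; first by rewrite normr0 expr0n !mulr0.
have f0' : 0 < `|f| ^+ 2 by rewrite exprn_gt0 // normr_gt0.
by rewrite (ger0_norm (ltW f0')) [leRHS]mulrC expr2 mulrA ler_pM2r.
Qed.

Lemma frame_operator_symmetric f g : dot (S f) g = dot f (S g).
Proof.
have h := cvg_sum_dot hK hH (y := g) (@frame_operator_cvg f).
have h' := cvg_sum_dotr (y := f) (@frame_operator_cvg g).
apply: (@cvg_sum_unique _ _ K^o _ _ _ h); move: h'; congr (_ @ totally `=>` _).
congr partial_sum; apply/funext => i.
have Wi := hW.1 i; rewrite dotZl dotZr (scalar_conj_nneg hK); last first.
  by rewrite exprn_ge0 // ltW ?hW.2.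
congr (_ * _); rewrite -(dot_orthprojl Wi g (orthproj_in Wi f)).
by rewrite dot_orthprojr //; exact: orthproj_in.
Qed.

(** Since [<x, S y> = <S x, y>] for all [x], the vector [S y] depends linearly
    on [y]; the bound passes to the limit from the finite sums. *)
Lemma frame_operator_bounded : bounded_op S.
Proof.
split=> [a x y|].
  apply: (dot_ext hH) => z.
  by rewrite dotDr dotZr -!frame_operator_symmetric dotDr dotZr.
exists D => f; apply: cvg_sum_norm_le (@frame_operator_cvg f) => J.
rewrite -ler_sqr ?nnegrE ?mulr_ge0 ?(ltW D0) //.
rewrite (le_trans (frame_sum_upper _ _)) // exprMn expr2 -mulrA ler_pM2l //.
exact: frame_upper.
Qed.

Lemma frame_operator_lower f : C * `|f| <= `|S f|.
Proof.
have [->|f0] := eqVneq f 0; first by rewrite normr0 mulr0.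
have f0' : 0 < `|f| by rewrite normr_gt0.
rewrite -(ler_pM2r f0') -mulrA -expr2 (le_trans (frame_form_lower f)) //.
by rewrite -(ger0_norm (frame_form_ge0 f)) cs_norm.
Qed.

(** The range of [S] is closed as [S] is bounded below, and a vector [g]
    orthogonal to it satisfies [<S g, g> = 0], hence vanishes. *)
Lemma frame_operator_invertible : invertible_op S.
Proof.
apply: (bounded_below_invertible frame_operator_bounded C0 frame_operator_lower).
move=> y.
have hV :=
  bounded_below_closed_range frame_operator_bounded C0 frame_operator_lower.
have [[x _ Sx] yx] := orthproj_spec hK hH y hV.
exists x; apply/esym/eqP; rewrite -subr_eq0 Sx -normr_eq0 -sqrf_eq0.
set g := y - _ in yx *.
have Sg : dot (S g) g = 0 by apply: (dot_eq0C hK); apply: yx; exists g.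
have := frame_form_lower g; rewrite Sg pmulr_rle0 // => gle.
by rewrite eq_le gle exprn_ge0.
Qed.

Lemma frame_bounds_Riesz : frame_bounds dot W w C (C + D).
Proof.
move=> f /=; have h := @frame_form_cvg f.
split; first by apply/cvg_ex; exists (dot (S f) f).
  by rewrite (sum_unique h); exact: frame_form_lower.
rewrite (sum_unique h) (@le_trans _ _ (D * `|f| ^+ 2)) //; last first.
  by rewrite ler_wpM2r ?exprn_ge0 // lerDr ltW.
apply: cvg_nneg_sum_le h => //; first by apply: ger0_real; exact: frame_form_ge0.
exact: frame_upper.
Qed.

Lemma Riesz_fusion_frame : fusion_frame dot W w.
Proof.
split=> //; exists C, (C + D); split; rewrite ?lerDl ?(ltW D0) //.
exact: frame_bounds_Riesz.
Qed.

(** The lower Riesz bound on finite subsets that contain [i] bounds [|h i|] by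
    the norms of partial sums, which tend to 0. *)
Lemma Riesz_sum_eq0 (h : I -> H) : (forall i, W i (h i)) ->
  partial_sum (fun i => w i *: h i) @ totally --> (0 : H) -> forall i, h i = 0.
Proof.
move=> Wh /cvg_sumP h0 i; apply/eqP; apply/negPn/negP => hi.
have e0 : 0 < C * `|h i| ^+ 2 by rewrite mulr_gt0 // exprn_gt0 // normr_gt0.
(* [e] is at most [C |h i|^2], and below 1 so that [e^2 < e]. *)
pose e := C * `|h i| ^+ 2 / (1 + C * `|h i| ^+ 2).
have e1 : 0 < 1 + C * `|h i| ^+ 2 by rewrite addr_gt0.
have ep : 0 < e by rewrite divr_gt0.
have [J0 /(_ _ (fsubsetUl J0 [fset i]%fset))] := h0 _ ep.
set J := (_ `|` _)%fset; rewrite sub0r normrN => hJ.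
have iJ : i \in J by rewrite !inE eqxx orbT.
have [//|hC _] := @hCD J h.
have e_lt1 : e < 1 by rewrite ltr_pdivrMr // mul1r ltrDr.
have e_le : e <= C * `|h i| ^+ 2.
  by rewrite ler_pdivrMr // mulrDr mulr1 lerDl mulr_ge0 // ltW.
have : `|\sum_(j <- J) w j *: h j| ^+ 2 < e.
  rewrite (@lt_trans _ _ (e ^+ 2)) // ?ltr_sqr ?nnegrE ?(ltW ep) //.
  by rewrite expr2 gtr_pMr.
move=> /(le_lt_trans hC) /lt_le_trans /(_ e_le) /lt_geF/negP; apply.
rewrite ler_pM2l // (big_fsetD1 i) //= lerDl.
by apply: sumr_ge0 => j _; exact: exprn_ge0.
Qed.

(** The key description of [S^-1 W_i]. If [S g] is in [W_i], moving it to the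
    left of its expansion gives an expansion of 0, whose coefficients vanish; if
    [g] is orthogonal to the other subspaces, the series of [S g] has one term. *)
Lemma frame_inverse_image i :
  inverse_op S @` W i =
  [set g | forall j, j != i -> forall x, W j x -> dot g x = 0].
Proof.
have [_ SK KS] := inverse_op_spec frame_operator_invertible.
rewrite (image_cancel _ KS SK); apply/seteqP; split=> g /=.
  move=> WSg j ji x Wx.
  pose h j := w j *: p j g - (if j == i then (w i)^-1 *: S g else 0).
  have : h j = 0.
    apply: Riesz_sum_eq0.
      move=> k; rewrite /h addrC -scaleN1r; apply: (hW.1 k).1.2; last exact: Ws.
      by case: eqP => [->|_]; [exact: Ws|exact: (hW.1 k).1.1].
    rewrite -(subrr (S g)).
    have single : partial_sum (fun k => if k == i then S g else 0) @ totally --> S g.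
      have := @cvg_sum_single _ _ _ (fun k => if k == i then S g else 0) i.
      by rewrite eqxx; apply=> k /negbTE ->.
    have := cvg_sumB (@frame_operator_cvg g) single.
    rewrite (_ : (fun k => w k *: h k) =
      fun k => w k ^+ 2 *: p k g - (if k == i then S g else 0)) //.
    apply/funext => k; rewrite /h scalerBr scalerA -expr2; case: eqP => [->|_].
      by rewrite scalerA divff // scale1r.
    by rewrite scaler0.
  rewrite /h (negbTE ji) subr0 => /eqP.
  rewrite scaler_eq0 (negbTE (w0 j)) /= => /eqP pg.
  by rewrite -(dot_orthprojr (hW.1 j)) // -/(p j g) pg dot0l.
move=> hg; have hS : S g = w i ^+ 2 *: p i g.
  apply: cvg_sum_unique (@frame_operator_cvg g) _.
  apply: (@cvg_sum_single _ _ _ (fun k => w k ^+ 2 *: p k g)) => j ji.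
  by rewrite [p j g]orthproj_eq0 ?scaler0 //; [exact: hW.1|exact: hg].
by rewrite hS; exact: Ws.
Qed.

End FrameOperator.
End Riesz.

(** * Orthogonal families and Parseval fusion frames *)

Section Orthogonal.
Variables (R : realType) (K : numFieldType) (theta : K -> K).
Hypothesis hK : scalar_field R theta.
Variables (H : completeNormedModType K) (dot : {dot H for theta}).
Hypothesis hH : hilbert_space dot.
Variable I : countType.
Implicit Types (W : I -> set H) (w : I -> K) (x y z f g : H).

Lemma orthogonal_sum_norm (f : I -> H) (J : {fset I}) :
  (forall i j, i \in J -> j \in J -> i != j -> dot (f i) (f j) = 0) ->
  `|\sum_(j <- J) f j| ^+ 2 = \sum_(j <- J) `|f j| ^+ 2.
Proof.
move=> hf; rewrite hH dot_suml big_seq [RHS]big_seq; apply: eq_bigr => i iJ.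
rewrite dot_sumr (big_fsetD1 i) //= big1_fset ?addr0 -?hH // => j.
by rewrite !inE => /andP[ji jJ] _; apply: hf => //; rewrite eq_sym.
Qed.

(** The family with unit weights is a fusion Riesz basis with bounds 1. Its
    frame operator fixes every [W i], and being symmetric it then fixes every
    vector by completeness; thus the sum [<S f, f>] is [|f|^2]. *)
Lemma orthogonal_Parseval W :
  (forall i, closed_subspace (W i)) ->
  closed_span (\bigcup_i W i) = [set: H] ->
  (forall i j, i != j -> forall x y, W i x -> W j y -> dot x y = 0) ->
  Parseval_fusion_frame dot W (fun=> 1).
Proof.
move=> hW hc orth; have hW1 : weighted_subspaces W (fun=> 1 : K) by split.
have h1 (J : {fset I}) (f : I -> H) : (forall j, j \in J -> W j (f j)) ->
    1 * (\sum_(j <- J) `|f j| ^+ 2) <= `|\sum_(j <- J) (1 : K) *: f j| ^+ 2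
    /\ `|\sum_(j <- J) (1 : K) *: f j| ^+ 2 <= 1 * (\sum_(j <- J) `|f j| ^+ 2).
  move=> Wf; have -> : \sum_(j <- J) (1 : K) *: f j = \sum_(j <- J) f j.
    by apply: eq_bigr => j _; rewrite scale1r.
  rewrite mul1r orthogonal_sum_norm // => i j iJ jJ ij.
  by apply: (orth _ _ ij); exact: Wf.
split=> // f /=; pose S := frame_operator dot W (fun=> 1).
have Sid i x : W i x -> S x = x.
  move=> Wx; have := frame_operator_cvg hK hH hW1 ltr01 h1 (f := x).
  move/cvg_sum_unique; apply; have := @cvg_sum_single _ _ _
    (fun j => (1 : K) ^+ 2 *: orthproj dot (W j) x) i.
  rewrite (orthproj_id hK hH (hW i) Wx) expr1n scale1r; apply=> j ji.
  rewrite (orthproj_eq0 hK hH) ?scaler0 // => v Wv.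
  by apply: (orth i j) => //; rewrite eq_sym.
have Sf : S f = f.
  apply/eqP; rewrite -subr_eq0; apply/eqP.
  apply: (complete_orth_eq0 hK hH hc) => i x Wx.
  by rewrite dotBr -(frame_operator_symmetric hK hH hW1 ltr01 h1) -/S (Sid i) // subrr.
have := frame_form_cvg hK hH hW1 ltr01 h1 (f := f); rewrite -/S Sf -hH => h.
by rewrite (sum_unique h) mul1r; split=> //; apply/cvg_ex; exists (`|f| ^+ 2).
Qed.

(** For [x] in [W i] the term of index [i] of the Parseval sum is already
    [|x|^2]. *)
Lemma Parseval_orthogonal W : Parseval_fusion_frame dot W (fun=> 1) ->
  forall i j, i != j -> forall x y, W i x -> W j y -> dot x y = 0.
Proof.
move=> [[hW _] hP] i j ij x y Wx Wy; have := hP x => /=.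
set t := fun _ => _; move=> [tc le1 le2].
have sumE : sum (t : I -> K^o) = `|x| ^+ 2.
  by apply/eqP; rewrite eq_le; move: le1 le2; rewrite mul1r => -> ->.
have tl : partial_sum (t : I -> K^o) @ totally --> (`|x| ^+ 2 : K^o).
  by rewrite -sumE.
have t0 k : 0 <= t k by rewrite /t expr1n mul1r exprn_ge0.
have := @cvg_nneg_sum_ge _ _ t _ [fset i; j]%fset t0 _ tl.
rewrite ger0_real ?exprn_ge0 // => /(_ isT).
rewrite (big_fsetD1 i) ?inE ?eqxx //= (big_fsetD1 j) ?inE ?eqxx ?orbT ?andbT 1?eq_sym //=.
rewrite {1}/t (orthproj_id hK hH (hW i) Wx) expr1n mul1r gerDl => h.
have : t j <= 0 by apply: le_trans h; rewrite lerDl sumr_ge0.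
rewrite /t expr1n mul1r => tj.
have pj : orthproj dot (W j) x = 0.
  by apply/eqP; rewrite -normr_eq0 -sqrf_eq0 eq_le tj exprn_ge0.
by rewrite -(dot_orthprojr hK hH (hW j)) // pj dot0l.
Qed.

(** * Images of fusion Riesz bases under invertible operators *)

(** Completeness is carried over by the continuity of [V], and the Riesz bounds
    by the bounds of [V] and of its inverse. *)
Lemma Riesz_image W w (V : H -> H) : fusion_Riesz_basis W w -> invertible_op V ->
  fusion_Riesz_basis (fun i => V @` W i) w.
Proof.
move=> [[hW w0] hc [C [D [C0 D0 hCD]]]] [bV [X [bX VX XV]]].
have VE A : V @` A = X @^-1` A by exact: image_cancel.
have hVW i : closed_subspace (V @` W i).
  by rewrite VE; apply: closed_subspace_preimage.
split; first by split.
  apply/seteqP; split=> // y _.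
  pose A := smallest (@linear_subspace K H) (\bigcup_i V @` W i).
  suff sub : [set: H] `<=` V @^-1` (closure A) by rewrite -(XV y); exact: sub.
  have cl : closed (V @^-1` closure A).
    apply: preimage_closed; last exact: closed_closure.
    by move=> x _; exact: (bounded_op_continuous bV).
  have sub : smallest (@linear_subspace K H) (\bigcup_i W i) `<=` V @^-1` closure A.
    apply: subset_trans (_ : V @^-1` A `<=` _); last first.
      by move=> x /=; exact: subset_closure.
    have [L LV _] := bounded_op_bundle bV.
    have [A0 Alin] : linear_subspace A.
      split=> [B [[B0 _] _]//|a u v Au Av B hB].
      by apply: hB.1.2; [exact: Au|exact: Av].
    apply: smallest_sub; last first.
      by move=> x [i _ Wx]; apply: sub_gen_smallest; exists i => //; exists x.
    rewrite -LV; split=> [|a u v]; rewrite /preimage /= ?linear0 // linearP.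
    exact: Alin.
  by rewrite -hc => x hx; apply: cl; exact: (closureS sub) hx.
have [L LV [M M0 hM]] := bounded_op_bundle bV.
have [L' LX [M' M'0 hM']] := bounded_op_bundle bX.
have MM0 : 0 < (M * M') ^+ 2 by rewrite exprn_gt0 // mulr_gt0.
exists (C / (M * M') ^+ 2), (D * (M * M') ^+ 2); split.
- exact: divr_gt0.
- exact: mulr_gt0.
move=> J f Wf; pose g j := L' (f j).
have Wg j : j \in J -> W j (g j) by move=> /Wf; rewrite VE /g LX.
have fE j : f j = L (g j) by rewrite /g LX LV XV.
have sumfE : \sum_(j <- J) w j *: f j = L (\sum_(j <- J) w j *: g j).
  by rewrite linear_sum; apply: eq_bigr => j _; rewrite linearZ /= -fE.
have sumgE : \sum_(j <- J) w j *: g j = L' (\sum_(j <- J) w j *: f j).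
  by rewrite linear_sum; apply: eq_bigr => j _; rewrite linearZ.
have sq (c : K) (u v : H) :
    0 < c -> `|u| <= c * `|v| -> `|u| ^+ 2 <= c ^+ 2 * `|v| ^+ 2.
  by move=> c0 uv; rewrite -exprMn ler_sqr ?nnegrE ?mulr_ge0 // ltW.
have fg : \sum_(j <- J) `|f j| ^+ 2 <= M ^+ 2 * \sum_(j <- J) `|g j| ^+ 2.
  by rewrite mulr_sumr ler_sum // => j _; apply: sq => //; rewrite fE; exact: hM.
have gf : \sum_(j <- J) `|g j| ^+ 2 <= M' ^+ 2 * \sum_(j <- J) `|f j| ^+ 2.
  by rewrite mulr_sumr ler_sum // => j _; apply: sq => //; exact: hM'.
have [lo up] := hCD J g Wg; split.
  rewrite mulrAC ler_pdivrMr // exprMn.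
  apply: (@le_trans _ _ (M ^+ 2 * (C * \sum_(j <- J) `|g j| ^+ 2))).
    by rewrite mulrCA ler_pM2l.
  rewrite [leRHS]mulrCA ler_pM2l ?exprn_gt0 // [leRHS]mulrC (le_trans lo) //.
  by rewrite sumgE; apply: sq => //; exact: hM'.
rewrite sumfE (le_trans (sq _ _ _ M0 (hM _))) //.
rewrite [leRHS](_ : _ = M ^+ 2 * (D * (M' ^+ 2 * \sum_(j <- J) `|f j| ^+ 2))).
  by rewrite ler_pM2l ?exprn_gt0 // (le_trans up) // ler_pM2l.
by ring.
Qed.

(** * Scalability *)

Section Scalability.
Variables (W : I -> set H) (w : I -> K).
Hypothesis hW : fusion_Riesz_basis W w.
Let S := frame_operator dot W w.
Let winv i := (w i)^-1.

Lemma weights_mulV : (fun i => w i * winv i) = (fun=> 1).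
Proof.
have [[_ w0] _ _] := hW.
by apply/funext => i; rewrite divff // gt_eqF // w0.
Qed.

Lemma Riesz_frame_operator_invertible : invertible_op S.
Proof.
have [hW' hc [C [D [C0 D0 hCD]]]] := hW.
exact: (frame_operator_invertible hK hH hW' hc C0 D0 hCD).
Qed.

Lemma Riesz_frame_operator_symmetric f g : dot (S f) g = dot f (S g).
Proof.
have [hW' hc [C [D [C0 D0 hCD]]]] := hW.
exact: (frame_operator_symmetric hK hH hW' D0 hCD).
Qed.

Lemma Riesz_inverse_image i : inverse_op S @` W i =
  [set g | forall j, j != i -> forall x, W j x -> dot g x = 0].
Proof.
have [hW' hc [C [D [C0 D0 hCD]]]] := hW.
exact: (frame_inverse_image hK hH hW' hc C0 D0 hCD).
Qed.

(** Both sides are the space of the vectors orthogonal to all [W j] with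
    [j != i]. The nontrivial inclusion takes such a [g] to
    [h = V^*^-1 g], which is orthogonal to all [V W_j] with [j != i];
    then [h] minus its projection to [V W_i] is orthogonal to all [V W_j], hence 0. *)
Lemma adjoint_square_image (V : H -> H) : invertible_op V ->
  (forall i j, i != j -> forall x y, (V @` W i) x -> (V @` W j) y -> dot x y = 0) ->
  forall i, (adjoint dot V \o V) @` W i = inverse_op S @` W i.
Proof.
move=> hV orth i; rewrite Riesz_inverse_image; apply/seteqP; split=> g.
  move=> [x Wx <-] j ji y Wy /=.
  apply: (dot_eq0C hK); rewrite -(adjoint_spec hK hH) ?hV.1 //; last exact: hV.1.
  by apply: (orth _ _ ji); [exists y|exists x].
move=> /= hg; have [_ VK KV] := inverse_op_spec (invertible_op_adjoint hK hH hV).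
set h := inverse_op (adjoint dot V) g in KV *.
have [[hVW _] hc _] := Riesz_image hW hV.
have hperp j : j != i -> forall y, (V @` W j) y -> dot y h = 0.
  move=> ji _ [y Wy <-]; rewrite (adjoint_spec hK hH hV.1) KV.
  by apply: (dot_eq0C hK); exact: hg Wy.
have [x Wx Vx] := orthproj_in hK hH (hVW i) h.
exists x => //=; rewrite -[RHS]KV; congr adjoint; rewrite Vx.
apply/eqP; rewrite eq_sym -subr_eq0; apply/eqP.
apply: (complete_orth_eq0 hK hH hc) => j y Vy.
rewrite dotBr; have [ji|ji] := eqVneq j i.
  by subst j; rewrite (dot_orthprojl hK hH (hVW i)) // subrr.
rewrite (hperp j ji) // sub0r; apply/eqP; rewrite oppr_eq0; apply/eqP.
by apply: (orth _ _ ji) => //; exact: (orthproj_in hK hH (hVW i)).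
Qed.

Lemma scalable_orthogonal (V : H -> H) : fusion_scalable dot W w V winv ->
  forall i j, i != j -> forall x y, (V @` W i) x -> (V @` W j) y -> dot x y = 0.
Proof.
by move=> [_ _ _]; rewrite weights_mulV; exact: Parseval_orthogonal.
Qed.

Lemma orthogonal_scalable (V : H -> H) : invertible_op V ->
  (forall i j, i != j -> forall x y, (V @` W i) x -> (V @` W j) y -> dot x y = 0) ->
  fusion_scalable dot W w V winv.
Proof.
move=> hV orth; have [hW' hc [C [D [C0 D0 hCD]]]] := hW.
have [[hVW _] hVc _] := Riesz_image hW hV; split=> //.
- exact: (Riesz_fusion_frame hK hH hW' hc C0 D0 hCD).
- by move=> i; rewrite invr_gt0; exact: hW'.2.
- by rewrite weights_mulV; exact: orthogonal_Parseval.
Qed.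

End Scalability.
End Orthogonal.

Theorem theorem2p5 (R : realType) (K : numFieldType) (theta : K -> K)
    (hK : scalar_field R theta)
    (H : completeNormedModType K) (dot : {dot H for theta})
    (hH : hilbert_space dot) (sepH : separable_space H)
    (I : countType) (W : I -> set H) (w : I -> K)
    (hW : fusion_Riesz_basis W w)
    (U : H -> H) (hU : invertible_op U) :
  let S := frame_operator dot W w in
  let winv := fun i => (w i)^-1 in
  [<-> fusion_scalable dot W w U winv;
       fusion_scalable dot W w (inverse_op (S \o adjoint dot U)) winv;
       forall i, (adjoint dot U \o U) @` W i = inverse_op S @` W i;
       orthogonal_fusion_Riesz_basis dot (fun i => U @` W i) w].
Proof.
move=> S winv.
have hS : invertible_op S by exact: (Riesz_frame_operator_invertible hK hH hW).
have hU' := invertible_op_adjoint hK hH hU.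
have [hVinv VK KV] := inverse_op_spec (invertible_op_comp hS hU').
set V := inverse_op _ in hVinv VK KV *.
have [_ SK KS] := inverse_op_spec hS.
have [_ UK KU] := inverse_op_spec hU.
tfae.
- move=> sU; have orth := scalable_orthogonal hK hH hW sU.
  have VW : (fun i => V @` W i) = (fun i => U @` W i).
    apply/funext => i; have := adjoint_square_image hK hH hW hU orth i.
    move=> E; apply/seteqP; split=> _ [x Wx <-].
      have : (inverse_op S @` W i) (inverse_op S x) by exists x.
      rewrite -E => -[y Wy /= yx]; exists y => //.
      by rewrite -[U y]VK /= yx KS.
    have : ((adjoint dot U \o U) @` W i) (adjoint dot U (U x)) by exists x.
    rewrite E => -[y Wy /= yx]; exists y => //.
    by rewrite -[U x]VK /= -yx KS.
  have [h1 _ h3 h4] := sU; split=> //.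
  by rewrite /Parseval_fusion_frame VW.
- move=> sV; have orth := scalable_orthogonal hK hH hW sV.
  have VE : adjoint dot V = inverse_op S \o inverse_op U.
    apply: (adjoint_eq hK hH hVinv.1) => x y; rewrite -[x in RHS]KV /=.
    rewrite (Riesz_frame_operator_symmetric hK hH hW) -/S KS.
    by rewrite [RHS]dotC -(adjoint_spec hK hH hU.1) KU -dotC.
  have AV x : adjoint dot U (V x) = inverse_op S x by rewrite -[in RHS](KV x) /= SK.
  move=> i; have := adjoint_square_image hK hH hW hVinv orth i; rewrite VE => E.
  have injSi : injective (inverse_op S) by exact: can_inj KS.
  apply/seteqP; split=> _ [x Wx <-].
    have : (((inverse_op S \o inverse_op U) \o V) @` W i) (inverse_op S x).
      by rewrite E; exists x.
    move=> [y Wy /= /injSi yx]; exists y => //.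
    by rewrite /= -yx KU AV.
  have : (inverse_op S @` W i) (inverse_op S (inverse_op U (V x))).
    by rewrite -E; exists x.
  move=> [y Wy /injSi yE]; exists y => //.
  by rewrite /= yE KU AV.
- move=> E; split; first exact: (Riesz_image hW hU).
  move=> i j ij _ _ [a Wa <-] [b Wb <-]; rewrite (adjoint_spec hK hH hU.1).
  apply: (dot_eq0C hK).
  have : ((adjoint dot U \o U) @` W j) (adjoint dot U (U b)) by exists b.
  by rewrite E (Riesz_inverse_image hK hH hW) => /(_ i ij a Wa).
- move=> [_ orth]; exact: (orthogonal_scalable hK hH hW hU).
Qed.
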